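(* Let $X$ be a Tychonoff space and let $\aleph_\alpha\geq\aleph_1$ be a cardinal. The following statements are equivalent: (1) $X$ is $\aleph_\alpha$-separable. (2) $C_{\aleph_\alpha}(X)=C_u(X)$ (the two topologies on $C(X)$ coincide). (3) $C_{\aleph_\alpha}(X)$ is metrizable by a complete metric. (4) $C_{\aleph_\alpha}(X)$ is first countable. (5) $C_{\aleph_\alpha}(X)$ is a q-space. (6) $C_{\aleph_\alpha}(X)$ is of pointwise countable type.
   Context: Tychonoff means completely regular and Hausdorff. The density of $X$ is $d(X)=\aleph_0+\min\{|D|: D \text{ dense in } X\}$; $X$ is $\aleph_\alpha$-separable if $d(X)<\aleph_\alpha$. $C(X)$ is the set of all real-valued continuous functions on $X$. For $f\in C(X)$, $A\subseteq X$ and real $\epsilon>0$ put $B(f,A,\epsilon)=\{g\in C(X): \sup_{x\in A}|f(x)-g(x)|<\epsilon\}$ (equal to $C(X)$ when $A=\emptyset$). For an infinite cardinal $\aleph_\alpha$, $C_{\aleph_\alpha}(X)$ is $C(X)$ with the topology having as base all sets $B(f,A,\epsilon)$ with $f\in C(X)$, $\epsilon>0$ and $A\subseteq X$, $|A|<\aleph_\alpha$. $C_u(X)$ is $C(X)$ with the topology of uniform convergence, in which the sets $B(f,X,\epsilon)$, $\epsilon>0$, form a neighborhood base at $f$. A subset $S$ of a space $Y$ has countable character if there is a sequence $(W_n)_{n\in\mathbb{N}}$ of open sets containing $S$ such that every open set containing $S$ contains some $W_n$. $Y$ is of pointwise countable type if every point of $Y$ lies in a compact set with countable character. $Y$ is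 a q-space if for each $y\in Y$ there is a sequence $(U_n)_{n\in\mathbb{N}}$ of neighborhoods of $y$ such that whenever $y_n\in U_n$ for all $n$, the sequence $(y_n)$ has a cluster point in $Y$. *)

(* Defs.v *)
From HB Require Import structures.
From mathcomp Require Import all_boot all_order all_algebra.
From mathcomp Require Import lra.
From mathcomp Require Import all_classical all_reals all_analysis.
Set Implicit Arguments.
Unset Strict Implicit.
Unset Printing Implicit Defensive.
Import Order.TTheory GRing.Theory Num.Theory.
Import numFieldNormedType.Exports.
Local Open Scope classical_set_scope.
Local Open Scope card_scope.
Local Open Scope ring_scope.

(* An infinite cardinal is represented by an arbitrary type of that
   cardinality; cardinalities are compared with [card_le]. *)
Record infinite_cardinal := InfiniteCardinal {
  cardinal_type :> Type;
  cardinal_infinite : infinite_set [set: cardinal_type]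
}.

Definition card_lt T U (A : set T) (B : set U) : Prop :=
  A #<= B /\ ~ (B #<= A).

Section cardinal_arithmetic.

Lemma card_le_relP T U (A : set T) (B : set U) :
  A #<= B <->
  exists r : T -> U -> Prop,
    (forall x, A x -> exists2 y, B y & r x y) /\
    (forall x x' y, A x -> A x' -> r x y -> r x' y -> x = x').
Proof.
split=> [|[r [rtot rinj]]].
  have [-> _|/set0P[a Aa]] := eqVneq A set0.
    by exists (fun _ _ => False); split => // x [].
  elim/Ppointed: U B => U B; first by rewrite card_le_emptyr => /eqP A0; rewrite A0 in Aa.
  move=> /pcard_leP [f]; exists (fun x y => y = f x); split.
    by move=> x Ax; exists (f x) => //; exact: funS.
  by move=> x x' y Ax Ax' -> /esym; move/esym; apply: inj; exact/mem_set.
have [->|/set0P[a Aa]] := eqVneq A set0; first exact: card_ge0.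
have [b _ _] := rtot a Aa.
have /choice[f fP] x : exists y, A x -> B y /\ r x y.
  have [Ax|nAx] := pselect (A x); last by exists b.
  by have [y By rxy] := rtot x Ax; exists y.
elim/Ppointed: U B r rtot rinj f b fP => U B r rtot rinj f b fP.
  by move: (no b).
apply/pcard_leP; apply/injfunPex; exists f.
  by move=> x Ax; have [] := fP x Ax.
move=> x x' /set_mem Ax /set_mem Ax' ff.
apply: (rinj _ _ (f x) Ax Ax'); first by have [] := fP x Ax.
by rewrite ff; have [] := fP x' Ax'.
Qed.

Lemma card_le_min T (F : set (set T)) : F !=set0 ->
  exists2 D, F D & forall E, F E -> D #<= E.
Proof.
move=> [D0 FD0].
pose P (Z : set (set T -> T)) := (forall g D, Z g -> F D -> D (g D)) /\
  (forall g h D, Z g -> Z h -> F D -> g D = h D -> g = h).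
have /Zorn_bigcup[Z [[Zin Zinj] Zmax]] : forall G : set (set (set T -> T)),
    G `<=` P -> total_on G subset -> P (\bigcup_(Z in G) Z).
  move=> G GP Gtot; split => [g D [Z GZ Zg] FD|].
    exact: (GP _ GZ).1 g D Zg FD.
  move=> g h D [Z GZ Zg] [Z' GZ' Z'h].
  have [ZZ'|Z'Z] := Gtot _ _ GZ GZ'.
    by move=> FD; apply: ((GP _ GZ').2 g h D) => //; exact: ZZ'.
  by move=> FD; apply: ((GP _ GZ).2 g h D) => //; exact: Z'Z.
have [[D FD DZ]|noD] :=
    pselect (exists2 D, F D & forall x, D x -> exists2 g, Z g & g D = x).
  exists D => // E FE; apply/card_le_relP.
  exists (fun x y => exists g, [/\ Z g, g D = x & g E = y]); split.
    move=> x /DZ[g Zg gD]; exists (g E); first exact: (Zin g E).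
    by exists g.
  move=> x x' y _ _ [g [Zg <- <-]] [h [Zh <- hg]].
  by rewrite (Zinj g h E) // hg.
exfalso.
have free D : F D -> exists2 x, D x & forall h, Z h -> h D <> x.
  move=> FD; apply: contrapT => H; apply: noD; exists D => // x Dx.
  apply: contrapT => noh; apply: H; exists x => // h Zh hD.
  by apply: noh; exists h.
have [x0 _ _] := free _ FD0.
have /choice[g gP] D : exists x, F D -> D x /\ forall h, Z h -> h D <> x.
  have [FD|nFD] := pselect (F D); last by exists x0.
  by have [x Dx xP] := free D FD; exists x.
have nZg : ~ Z g by move=> Zg; exact: (gP _ FD0).2 Zg erefl.
apply: (Zmax (Z `|` [set g])).
  by split; [move=> h; left | move=> /(_ g (or_intror erefl))].
split.
  by move=> h D [Zh|->] FD; [exact: (Zin h D) | have [] := gP D FD].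
move=> h k D [Zh|->] [Zk|->] FD //.
- exact: (Zinj h k D).
- by move=> hg; have := (gP _ FD).2 _ Zh hg.
- by move=> /esym kg; have := (gP _ FD).2 _ Zk kg.
Qed.

Lemma countable_enum T (C : set T) : countable C -> infinite_set C ->
  exists g : nat -> T,
    [/\ injective g, forall n, C (g n) & forall x, C x -> exists n, g n = x].
Proof.
move=> Ccnt Cinf; have [c _] := infinite_setN0 Cinf.
have := eq_card_nat Ccnt Cinf; rewrite card_eq_sym.
elim/Ppointed: T C c Ccnt Cinf => T C c Ccnt Cinf; first by move: (no c).
move=> /card_set_bijP[g [gC ginj gsurj]]; exists g; split.
- by move=> n m; apply: ginj; exact/mem_set.
- by move=> n; exact: gC.
- by move=> x /gsurj[n _ <-]; exists n.
Qed.

Lemma infinite_partition T (B : set T) : infinite_set B ->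
  exists Z : set (nat -> T),
    [/\ forall s n, Z s -> B (s n),
        forall s s' n m, Z s -> Z s' -> s n = s' m -> s = s' /\ n = m
      & forall x, B x -> exists2 s, Z s & exists n, s n = x].
Proof.
move=> Binf.
pose P (Z : set (nat -> T)) := (forall s n, Z s -> B (s n)) /\
  (forall s s' n m, Z s -> Z s' -> s n = s' m -> s = s' /\ n = m).
have /Zorn_bigcup[Z [[Zin Zinj] Zmax]] : forall G : set (set (nat -> T)),
    G `<=` P -> total_on G subset -> P (\bigcup_(Z in G) Z).
  move=> G GP Gtot; split => [s n [Z GZ Zs]|]; first exact: (GP _ GZ).1 s n Zs.
  move=> g h n m [Z GZ Zg] [Z' GZ' Z'h].
  have [ZZ'|Z'Z] := Gtot _ _ GZ GZ'.
    by apply: ((GP _ GZ').2 g h n m) => //; exact: ZZ'.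
  by apply: ((GP _ GZ).2 g h n m) => //; exact: Z'Z.
have seqP (C : set T) : infinite_set C ->
    exists2 s : nat -> T, injective s & forall n, C (s n).
  move=> /[dup] /infinite_setN0[c _] /infiniteP /card_le_relP[r [rtot rinj]].
  have /choice[s sP] n : exists x, C x /\ r n x.
    by have [x Cx rx] := rtot n I; exists x.
  exists s => [n m nm|n]; last exact: (sP n).1.
  by apply: (rinj _ _ (s n)) => //; [exact: (sP n).2|rewrite nm; exact: (sP m).2].
pose R := B `\` \bigcup_(s in Z) range s.
have Rfin : finite_set R.
  apply: contrapT => /seqP[s sinj sR].
  have nZs : ~ Z s by move=> Zs; have [_] := sR 0%N; apply; exists s => //; exists 0%N.
  apply: (Zmax (Z `|` [set s])).
    by split; [move=> h; left | move=> /(_ s (or_intror erefl))].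
  split.
    by move=> h n [Zh|->]; [exact: Zin | have [] := sR n].
  move=> h k n m [Zh|->] [Zk|->].
  - exact: Zinj.
  - by move=> hs; have [_] := sR m; case; exists h => //; exists n.
  - by move=> hs; have [_] := sR n; case; exists k => //; exists m.
  - by move=> /sinj.
have [s0 Zs0] : exists s, Z s.
  apply: contrapT => noZ; apply: Binf; apply: sub_finite_set Rfin => x Bx.
  by split => // -[s Zs]; case: noZ; exists s.
have s0inj : injective s0 by move=> n m /(Zinj _ _ _ _ Zs0 Zs0)[].
pose C := R `|` range s0.
have Ccnt : countable C.
  suff -> : C = \bigcup_(b in [set: bool]) (if b then R else range s0).
    apply: bigcup_countable => // -[] _; first exact: finite_set_countable.
    exact: card_image_le.
  apply/seteqP; split=> x; first by move=> [Rx|sx]; [exists true|exists false].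
  by move=> [[] _ xC]; [left|right].
have Cinf : infinite_set C.
  apply: (@sub_infinite_set _ (range s0)); first by move=> x; right.
  apply/infiniteP/card_le_relP; exists (fun n x => s0 n = x); split.
    by move=> n _; exists (s0 n) => //; exists n.
  by move=> n m x _ _ <- /esym/s0inj.
have [g [ginj gC Cg]] := countable_enum Ccnt Cinf.
exists ([set g] `|` (Z `\ s0)); split.
- move=> s n [->|[Zs _]]; last exact: Zin.
  by have [[]//|[m _ <-]] := gC n; exact: Zin.
- have disj s n m : (Z `\ s0) s -> s n <> g m.
    move=> [Zs ss0] sg; have [[_]|[k _]] := gC m.
      by apply; exists s => //; exists n.
    by rewrite -sg => /(Zinj _ _ _ _ Zs0 Zs)[/esym].
  move=> s s' n m [->|Zs] [->|Zs'].
  + by move=> /ginj.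
  + by move=> /esym /(disj _ _ _ Zs').
  + by move=> /(disj _ _ _ Zs).
  + by apply: Zinj; [case: Zs|case: Zs'].
- move=> x Bx; have [Cx|nCx] := pselect (C x).
    by have [n gn] := Cg x Cx; exists g; [left|exists n].
  have [[s Zs [n _ sn]]|nx] := pselect ((\bigcup_(s in Z) range s) x).
    exists s; last by exists n.
    by right; split => // ss0; apply: nCx; right; exists n => //; rewrite -ss0.
  by exfalso; apply: nCx; left.
Qed.

Lemma card_setU_le T (A B : set T) :
  infinite_set B -> A #<= B -> A `|` B #<= B.
Proof.
move=> /infinite_partition[Z [Zin Zinj Zcov]] /card_le_relP[r [rtot rinj]].
apply/card_le_relP; exists (fun x y => exists s n, Z s /\
  ((A x /\ r x (s n) /\ y = s n.*2) \/ (~ A x /\ x = s n /\ y = s n.*2.+1))).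
split.
  move=> x ABx; have [Ax|nAx] := pselect (A x).
    have [y By rxy] := rtot x Ax; have [s Zs [n sn]] := Zcov y By.
    exists (s n.*2); first exact: Zin.
    by exists s, n; split => //; left; rewrite sn.
  have Bx : B x by case: ABx.
  have [s Zs [n sn]] := Zcov x Bx.
  exists (s n.*2.+1); first exact: Zin.
  by exists s, n; split => //; right.
move=> x x' y _ _ [s [n [Zs H]]] [s' [n' [Zs' H']]].
case: H => -[Ax [xs ys]]; case: H' => -[Ax' [xs' ys']].
- have [ss nn] : s = s' /\ n.*2 = n'.*2 by apply: Zinj => //; rewrite -ys.
  by apply: (rinj _ _ (s n)) => //; rewrite ss (double_inj nn).
- have [_ /(congr1 odd)] : s = s' /\ n.*2 = n'.*2.+1.
    by apply: Zinj => //; rewrite -ys.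
  by rewrite /= !odd_double.
- have [_ /(congr1 odd)] : s = s' /\ n.*2.+1 = n'.*2.
    by apply: Zinj => //; rewrite -ys.
  by rewrite /= !odd_double.
- have [ss [nn]] : s = s' /\ n.*2.+1 = n'.*2.+1.
    by apply: Zinj => //; rewrite -ys.
  by rewrite xs xs' ss (double_inj nn).
Qed.

Lemma card_ltU T (kappa : infinite_cardinal) (A B : set T) :
  card_lt A [set: kappa] -> card_lt B [set: kappa] ->
  card_lt (A `|` B) [set: kappa].
Proof.
wlog AB : A B / A #<= B.
  move=> H ltA ltB.
  have [D [->|->] DP] := @card_le_min T [set A; B] (ex_intro _ A (or_introl erefl)).
    by apply: H => //; apply: DP; right.
  by rewrite setUC; apply: H => //; apply: DP; left.
move=> _ [leB nleB]; have [Bfin|Binf] := pselect (finite_set B).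
  have Afin : finite_set A by exact: card_le_finite AB Bfin.
  have ABfin : finite_set (A `|` B) by rewrite finite_setU.
  have kinf := @cardinal_infinite kappa; split.
    apply: (card_le_trans (finite_set_countable ABfin)); exact/infiniteP.
  by move=> /card_le_finite/(_ ABfin).
have ABB := card_setU_le Binf AB.
split; first exact: card_le_trans ABB leB.
by move=> /card_le_trans/(_ ABB).
Qed.

End cardinal_arithmetic.

Definition tychonoff_space (X : topologicalType) :=
  completely_regular_space X /\ hausdorff_space X.

Section density.
Variable X : topologicalType.

Definition least_dense (D : set X) :=
  dense D /\ forall E : set X, dense E -> D #<= E.

Lemma ex_least_dense : exists D, least_dense D.
Proof.
have [|D dD DP] := @card_le_min _ (@dense X); last by exists D.
by exists setT => O [x Ox] _; exists x.
Qed.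

(* A set of cardinality [aleph_0 + |D|], where [D] is a dense set of least
   cardinality. *)
Definition density : set (nat + X) :=
  [set t | if t is inr x then xget setT least_dense x else True].

Definition card_separable (kappa : infinite_cardinal) :=
  card_lt density [set: kappa].

End density.

Section function_spaces.
Variables (R : realType) (X : topologicalType).
Implicit Types (f g : continuousType X R) (A : set X) (e : R).

(* The supremum is taken in the extended reals, so that it is [-oo] when [A]
   is empty and [+oo] when the difference is unbounded. *)
Definition sup_ball f A e : set (continuousType X R) :=
  [set g | ereal_sup [set `|f x - g x|%:E | x in A] < e%:E]%E.

Lemma sup_ballP f A e g : 0 < e ->
  sup_ball f A e g <-> exists2 d, 0 < d < e & forall x, A x -> `|f x - g x| <= d.
Proof.
move=> e0; split=> [|[d /andP[d0 de] fg]]; last first.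
  rewrite /sup_ball/=; apply: (@le_lt_trans _ _ d%:E); last by rewrite lte_fin.
  by apply: ge_ereal_sup => _ [x Ax <-]; rewrite lee_fin; exact: fg.
rewrite /sup_ball/=; set s := ereal_sup _ => se.
have fgs x : A x -> (`|f x - g x|%:E <= s)%E.
  by move=> Ax; apply: ereal_sup_ubound; exists x.
pose d0 : R := fine (Order.max s 0%E).
have max_s : Order.max s 0%E = d0%:E.
  rewrite /d0 fineK// fin_real//; apply/andP; split.
    by rewrite lt_max ltNy0 orbT.
  by rewrite gt_max (lt_le_trans se) ?leey//= ltry.
have d00 : 0 <= d0 by rewrite -lee_fin -max_s le_max lexx orbT.
have d0e : d0 < e by rewrite -lte_fin -max_s gt_max se lte_fin.
exists ((d0 + e) / 2); first by rewrite midf_lt// andbT; lra.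
move=> x Ax; have : (`|f x - g x|%:E <= d0%:E)%E.
  by rewrite -max_s le_max fgs.
rewrite lee_fin => fgd; lra.
Qed.

Definition C_u : Type := initial_topology
  (fun f : continuousType X R => (f : X -> R) : {uniform X -> R}).

HB.instance Definition _ := Topological.on C_u.

Lemma C_u_nbhsP f (U : set (continuousType X R)) :
  nbhs (f : C_u) U <-> exists2 e, 0 < e & sup_ball f setT e `<=` U.
Proof.
have -> : nbhs (f : C_u) U <-> exists2 V,
    nbhs ((f : X -> R) : {uniform X -> R}) V &
    [set g : continuousType X R | V (g : X -> R)] `<=` U.
  split=> [|[V]].
    rewrite nbhsE => -[W [[V oV <-] Vf] VU]; exists V => //.
    exact: open_nbhs_nbhs.
  rewrite nbhsE => -[W [oW Wf] WV] VU.
  rewrite nbhsE; exists [set g : C_u | W (g : X -> R)].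
    by split => //; exists W.
  by move=> g Wg; apply: VU; exact: WV.
split=> [[V /uniform_nbhs[E [entE EV]] VU]|[e e0 eU]].
  move: entE; rewrite -entourage_ballE => -[e /= e0 eE].
  exists e => // g /sup_ballP -/(_ e0)[d /andP[_ de] gd].
  apply/VU/EV => x _; apply: eE; rewrite /= -ball_normE/=.
  exact: le_lt_trans (gd x I) de.
exists [set g : X -> R | forall x, `|f x - g x| < e / 2].
  apply/uniform_nbhs; exists [set xy : R * R | `|xy.1 - xy.2| < e / 2].
  split; last by move=> g /= gP x; exact: gP.
  rewrite -entourage_ballE; exists (e / 2); first exact: divr_gt0.
  by move=> [x y]; rewrite /= -ball_normE.
move=> g gP; apply: eU; apply/sup_ballP => //; exists (e / 2); first lra.
by move=> x _; exact/ltW.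
Qed.

Section sup_ball_base.
Variable kappa : infinite_cardinal.

Definition sup_ball_base : set (set (continuousType X R)) :=
  [set B | exists f A e,
    [/\ 0 < e, card_lt A [set: kappa] & B = sup_ball f A e]].

Lemma sup_ball_base_cover : \bigcup_(B in sup_ball_base) B = setT.
Proof.
apply/seteqP; split=> // f _.
exists (sup_ball f set0 1).
  exists f, set0, 1; split => //; split; first exact: card_ge0.
  by move=> /card_le_finite/(_ (finite_set0 _)); exact: cardinal_infinite.
by rewrite /sup_ball/= image_set0 ereal_sup0 ltNyr.
Qed.

Lemma sup_ball_base_join (B1 B2 : set (continuousType X R)) f :
  sup_ball_base B1 -> sup_ball_base B2 -> B1 f -> B2 f ->
  exists B, [/\ sup_ball_base B, B f & B `<=` B1 `&` B2].
Proof.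
move=> [f1 [A1 [e1 [e10 ltA1 ->]]]] [f2 [A2 [e2 [e20 ltA2 ->]]]].
move=> /(sup_ballP _ _ _ e10)[d1 /andP[d10 de1] fd1].
move=> /(sup_ballP _ _ _ e20)[d2 /andP[d20 de2] fd2].
pose e := Num.min (e1 - d1) (e2 - d2).
have e0 : 0 < e by rewrite lt_min !subr_gt0 de1.
exists (sup_ball f (A1 `|` A2) e); split.
- by exists f, (A1 `|` A2), e; split => //; exact: card_ltU.
- by apply/sup_ballP => //; exists (e / 2) => [|x _]; [lra|rewrite subrr normr0; lra].
- move=> g /(sup_ballP _ _ _ e0)[d /andP[d0]]; rewrite lt_min => /andP[dd1 dd2] gd.
  split; apply/sup_ballP => //.
    exists (d1 + d) => [|x Ax]; first lra.
    apply: le_trans (ler_distD (f x) _ _) _.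
    by rewrite lerD ?fd1 ?gd//; left.
  exists (d2 + d) => [|x Ax]; first lra.
  apply: le_trans (ler_distD (f x) _ _) _.
  by rewrite lerD ?fd2 ?gd//; right.
Qed.

End sup_ball_base.

Definition C_card (kappa : infinite_cardinal) : Type := continuousType X R.

Section C_card_topology.
Variable kappa : infinite_cardinal.
Local Notation C_card := (C_card kappa).

HB.instance Definition _ := Choice.on C_card.
HB.instance Definition _ := @isBaseTopological.Build C_card
  (set (continuousType X R)) (sup_ball_base kappa)
  id (sup_ball_base_cover kappa) (@sup_ball_base_join kappa).

End C_card_topology.
End function_spaces.

Section topological_properties.
Variable Y : topologicalType.

Definition first_countable := forall y : Y,
  exists2 B : set (set Y), countable B & B `<=` nbhs y /\ filter_from B id --> y.

Definition countable_character (S : set Y) := exists W : nat -> set Y,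
  (forall n, open (W n) /\ S `<=` W n) /\
  forall U, open U -> S `<=` U -> exists n, W n `<=` U.

Definition pointwise_countable_type := forall y : Y,
  exists S : set Y, [/\ S y, compact S & countable_character S].

Definition q_space := forall y : Y, exists U : nat -> set Y,
  (forall n, nbhs y (U n)) /\
  forall u : nat -> Y, (forall n, U n (u n)) -> cluster (u @ \oo) !=set0.

Definition completely_metrizable (R : realType) := exists d : Y -> Y -> R,
  [/\ [/\ forall x y, 0 <= d x y, forall x y, d x y = 0 <-> x = y,
          forall x y, d x y = d y x & forall x y z, d x z <= d x y + d y z],
      forall x (U : set Y),
        nbhs x U <-> exists2 e, 0 < e & [set y | d x y < e] `<=` U
    & forall u : nat -> Y,
        (forall e, 0 < e ->
           exists N, forall m n, (N <= m)%N -> (N <= n)%N -> d (u m) (u n) < e) ->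
        exists l : Y, u @ \oo --> l].

End topological_properties.

(* Main.v *)
(* If a dense set [D] has cardinality below [kappa] then
   [B(f, D, e) = B(f, X, e)] by continuity, so the two topologies coincide and
   the truncated supremum distance is a complete metric.  In a first countable
   space every singleton is a compact set of countable character, and pointwise
   countable type always implies the q-property.  It remains to show that the
   q-property at [0] yields a small dense set.  Otherwise, given neighborhoods
   containing [B(0, A_n, e_n)], choose increasing small sets [S_n] containing
   [A_n] and points [x_n], outside the closure of [S_n] but in [S_m] for [m > n],
   and continuous [f_n] vanishing on [S_n] with [f_n(x_n) = 1].  The [f_n] have
   a cluster point [g], and [{x_n}] is countable, so some [f_m] and some [f_n]
   with [n > m] are both within [1/2] of [g] on all of [{x_n}]; this fails at
   [x_m]. *)
From HB Require Import structures.
Require Import Defs.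
From mathcomp Require Import all_boot all_order all_algebra.
From mathcomp Require Import lra.
From mathcomp Require Import all_classical all_reals all_analysis.
Set Implicit Arguments.
Unset Strict Implicit.
Import Order.TTheory GRing.Theory Num.Theory.
Import numFieldNormedType.Exports.
Local Open Scope classical_set_scope.
Local Open Scope ring_scope.

(** * Cardinalities below [kappa] and density *)

Lemma card_lt_le_trans T U V (A : set T) (B : set U) (C : set V) :
  (A #<= B)%card -> card_lt B C -> card_lt A C.
Proof.
move=> AB [BC nCB]; split; first exact: card_le_trans AB BC.
by move=> CA; apply: nCB; exact: card_le_trans CA AB.
Qed.

Lemma countable_card_lt T (kappa : infinite_cardinal) (A : set T) :
  ~ countable [set: kappa] -> countable A -> card_lt A [set: kappa].
Proof.
move=> ncount cA; split; last by move=> /sub_countable/(_ cA).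
by apply: (card_le_trans cA); apply/infiniteP/cardinal_infinite.
Qed.

(** The countable summand [nat] of [density] lies below the uncountable [kappa], and a union of two
    sets below [kappa] stays below [kappa]. *)
Lemma card_separableP (X : topologicalType) (kappa : infinite_cardinal) :
  ~ countable [set: kappa] ->
  card_separable X kappa <->
  exists2 D : set X, dense D & card_lt D [set: kappa].
Proof.
move=> ncount.
have [dL leL] : least_dense (xget setT (@least_dense X)).
  by have [D] := ex_least_dense X; exact: xgetI.
set L := xget _ _ in dL leL.
split=> [sepX|[D dD ltD]].
  exists L => //; apply: card_lt_le_trans sepX.
  have /card_le_eql <- : (@inr nat X @` L #= L)%card.
    by apply: inj_card_eq => x y _ _ [].
  by apply: subset_card_le => _ [x Lx <-].
have -> : card_separable X kappa =
    card_lt (range inl `|` inr @` L : set (nat + X)) [set: kappa].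
  congr (card_lt _ _); apply/seteqP; split=> -[n|x]//=.
  - by move=> _; left; exists n.
  - by move=> Lx; right; exists x.
  - by case=> -[y]// Ly [<-].
apply: card_ltU.
  by apply: countable_card_lt => //; exact: card_image_le.
apply: card_lt_le_trans ltD; apply: card_le_trans (leL D dD).
exact: card_image_le.
Qed.

(** * First countability, pointwise countable type and the q-property *)

Lemma first_countable_pointwise_countable_type (Y : topologicalType) :
  first_countable Y -> pointwise_countable_type Y.
Proof.
move=> fcY y; have [B cB [By yB]] := fcY y.
exists [set y]; split => //; first exact: compact_set1.
(* A member of [B] is needed so that [B] can be enumerated by all of [nat]. *)
have [V BV _] := yB _ (filterT : nbhs y setT).
have [W BW WB] : exists2 W : nat -> set Y, (forall n, B (W n)) &
    forall U, B U -> exists n, W n = U.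
  move: cB => /pfcard_geP[B0|[g]]; first by rewrite B0 in BV.
  exists g => [n|U BU]; first exact: funS.
  by have [n _ <-] := 'surj_g BU; exists n.
exists (fun n => (W n)^°); split=> [n|U oU /(_ y erefl) Uy].
  split; first exact: open_interior.
  by move=> _ ->; exact/By/BW.
have [V' BV' V'U] := yB _ (open_nbhs_nbhs (conj oU Uy)).
have [n Wn] := WB V' BV'; exists n.
by apply: subset_trans V'U; rewrite -Wn; exact: interior_subset.
Qed.

(** If [u] had no cluster point, compactness of [S] would give one tail of [u] that some open set
    around [S] misses. This open set contains some [W k], which holds late terms of [u]: a
    contradiction. *)
Lemma pointwise_countable_type_q_space (Y : topologicalType) :
  pointwise_countable_type Y -> q_space Y.
Proof.
move=> pctY y; have [S [Sy cS [W [WP WS]]]] := pctY y.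
(* Finite intersections make the sequence decreasing, so [W k] contains [u m] for every [m >= k]. *)
pose U n := [set z | forall i, (i <= n)%N -> W i z].
exists U; split=> [n|u uU].
  elim: n => [|n IHn].
    have [oW SW] := WP 0%N; apply: (@filterS _ _ _ (W 0%N)).
      by move=> z Wz i; rewrite leqn0 => /eqP ->.
    by apply: open_nbhs_nbhs; split => //; exact: SW.
  have [oW SW] := WP n.+1; apply: (@filterS _ _ _ (U n `&` W n.+1)).
    by move=> z [Uz Wz] i; rewrite leq_eqVlt => /orP[/eqP ->|/Uz].
  by apply: filterI => //; apply: open_nbhs_nbhs; split => //; exact: SW.
apply: contrapT => nou.
pose tail n := [set u m | m in [set m | (n <= m)%N]].
(* A near covering only gives pointwise information, so the covering relation
   is stated with the interior of the complement of the tail. *)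
have far : \forall n \near \oo, S `<=` (~` tail n)^°.
  move/compact_near_coveringP: cS; apply => s _.
  have [A [B [nA nB AB]]] :
      exists A B, [/\ (u @ \oo) A, nbhs s B & A `&` B = set0].
    apply: contrapT => noAB; apply: nou; exists s => A B nA nB.
    by apply/set0P/eqP => AB; apply: noAB; exists A, B.
  have [N _ NA] := nA; exists (B^°, [set n | (N <= n)%N]) => /=.
    by split; [exact: nbhs_interior|exists N].
  move=> [z n]/= [Bz Nn]; apply: filterS Bz => x Bx [m nm umx].
  suff : (A `&` B) x by rewrite AB.
  by split => //; rewrite -umx; apply: NA; exact: leq_trans nm.
have [N _ /(_ N (leqnn N)) SN] := far.
have [k Wk] := WS _ (open_interior _) SN.
have uW : W k (u (maxn N k)) by apply: (uU (maxn N k)); exact: leq_maxr.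
have /nbhs_singleton := Wk _ uW; apply.
by exists (maxn N k) => //; exact: leq_maxl.
Qed.

(** * Neighborhoods in [C_card], and a small dense set from the q-property *)

Lemma C_card_nbhsP (R : realType) (X : topologicalType)
    (kappa : infinite_cardinal) (f : continuousType X R)
    (U : set (continuousType X R)) :
  nbhs (f : C_card R X kappa) U <-> exists A e,
    [/\ 0 < e, card_lt A [set: kappa] & sup_ball f A e `<=` U].
Proof.
rewrite nbhsE; split=> [[V [[D' D'base <-] [B D'B Bf]] VU]|].
  have [g [A [e [e0 ltA BE]]]] := D'base _ D'B.
  rewrite /= BE in D'B Bf.
  move: Bf => /(sup_ballP _ _ _ e0)[d /andP[d0 de] gf].
  (* The base ball is centred at [g]; the slack [e - d] is the radius of a ball recentred at [f]
     inside it. *)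
  have ed0 : 0 < e - d by rewrite subr_gt0.
  exists A, (e - d); split => // h /(sup_ballP _ _ _ ed0)[d' /andP[d'0 d'e] fh].
  apply: VU; exists (sup_ball g A e) => //; apply/sup_ballP => //.
  exists (d + d') => [|x Ax]; first lra.
  by apply: le_trans (ler_distD (f x) _ _) _; rewrite lerD ?gf ?fh.
move=> [A [e [e0 ltA AU]]]; exists (sup_ball f A e) => //; split.
  by exists [set sup_ball f A e]; [move=> _ ->; exists f, A, e|rewrite bigcup_set1].
by apply/sup_ballP => //; exists (e / 2) => [|x _]; [lra|rewrite subrr normr0; lra].
Qed.

Definition continuous_pack (X Y : topologicalType) (f : X -> Y)
  (cf : continuous f) : continuousType X Y :=
  HB.pack f (isContinuous.Build X Y f cf).

Lemma completely_regular_function (R : realType) (X : topologicalType)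
    (A : set X) (x : X) :
  completely_regular_space X -> ~ closure A x ->
  exists f : continuousType X R, f x = 1 /\ forall a, A a -> f a = 0.
Proof.
move=> crX nAx.
have /(@uniform_separatorP _ R)[f [cf _ fx fA]] := crX x _ (@closed_closure _ A) nAx.
(* The separating function is 0 at [x] and 1 on the closure of [A]; the values are swapped. *)
have c1f : continuous (fun z => 1 - f z).
  by move=> z; apply: cvgB; [exact: cvg_cst|exact: cf].
exists (continuous_pack c1f); split=> [|a Aa] /=.
  by rewrite (fx (f x)) ?subr0//; exists x.
by rewrite (fA (f a)) ?subrr//; exists a => //; exact: subset_closure.
Qed.

Lemma q_space_card_separable (R : realType) (X : topologicalType)
    (kappa : infinite_cardinal) :
  completely_regular_space X -> ~ countable [set: kappa] ->
  q_space (C_card R X kappa) -> card_separable X kappa.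
Proof.
move=> crX ncount qC; apply/card_separableP => //; apply: contrapT => nosep.
have c0 : continuous (cst 0 : X -> R) by move=> z; exact: cvg_cst.
pose zero : continuousType X R := continuous_pack c0.
have [U [nU clU]] := qC zero.
have /choice[A AP] n : exists A : set X, card_lt A [set: kappa] /\
    forall g : continuousType X R, (forall a, A a -> g a = 0) -> U n g.
  have /C_card_nbhsP[A [e [e0 ltA AU]]] := nU n.
  exists A; split => // g gA; apply: AU; apply/sup_ballP => //.
  exists (e / 2) => [|a Aa]; first lra.
  by rewrite gA// subrr normr0; lra.
have escape (B : set X) : exists x, card_lt B [set: kappa] -> ~ closure B x.
  have [ltB|nltB] := pselect (card_lt B [set: kappa]).
    have /denseNE[V [[x [oV Vx]] VB]] : ~ dense B.
      by move=> dB; apply: nosep; exists B.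
    exists x => _ /(_ V (open_nbhs_nbhs (conj oV Vx))).
    by rewrite setIC VB => -[].
  (* For a large [B] any point serves; [X] has one, since otherwise the empty set would be dense. *)
  have [x _] : [set: X] !=set0; last by exists x.
  apply/set0P/eqP => X0; apply: nosep; exists set0.
    by move=> V [x _]; have : [set: X] x by []; rewrite X0.
  exact: countable_card_lt.
have [p pP] := choice escape.
pose S := fix S n := if n is m.+1 then S m `|` A n `|` [set p (S m)] else A 0%N.
have ltS n : card_lt (S n) [set: kappa].
  elim: n => [|n IHn] /=; first by have [] := AP 0%N.
  apply: card_ltU; last exact: countable_card_lt.
  by apply: card_ltU => //; have [] := AP n.+1.
have AS n : A n `<=` S n by case: n => // n x Ax; left; right.
have homoS m n : (m <= n)%N -> S m `<=` S n.
  elim: n => [|n IHn]; first by rewrite leqn0 => /eqP ->.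
  by rewrite leq_eqVlt => /orP[/eqP -> //|/IHn mn x /mn]; left; left.
have pS m n : (m < n)%N -> S n (p (S m)).
  by move=> /homoS; apply; right.
have /choice[f fP] n := completely_regular_function R crX (pP _ (ltS n)).
have [g clg] : cluster ((f : nat -> C_card R X kappa) @ \oo) !=set0.
  by apply: clU => n; apply: (AP n).2 => a /AS; exact: (fP n).2.
pose E := [set p (S n) | n in [set: nat]].
have ltE : card_lt E [set: kappa].
  by apply: countable_card_lt => //; exact: card_image_le.
(* Since [E] is countable, the ball around [g] over [E] is a neighborhood of [g], so it meets every
   tail of [f]. *)
have near_g n : exists2 m, (n <= m)%N &
    forall k, `|g (p (S k)) - f m (p (S k))| < 1 / 2.
  have /clg : ((f : nat -> C_card R X kappa) @ \oo)
      [set h | exists2 m, (n <= m)%N & h = f m].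
    by exists n => // m nm; exists m.
  have nbg : nbhs (g : C_card R X kappa) (sup_ball g E (1 / 2)).
    by apply/C_card_nbhsP; exists E, (1 / 2); split => //; lra.
  move=> /(_ _ nbg)[_ [[m nm ->] /sup_ballP]].
  have h0 : 0 < 1 / 2 :> R by lra.
  move=> /(_ h0)[d /andP[_ d2] gd]; exists m => // k.
  by apply: le_lt_trans d2; apply: gd; exists k.
have [m _ gm] := near_g 0%N.
have [n mn gn] := near_g m.+1.
(* At [p (S m)] the function [f m] is 1 and [f n] is 0, so [g] would be within 1/2 of both. *)
move: (gm m) (gn m); rewrite (fP m).1 (fP n).2 ?subr0; last exact: pS.
by rewrite !ltr_norml; lra.
Qed.

(** The set where [|f - g|] exceeds [d] is open; were it nonempty, it would meet [D]. *)
Lemma dense_sup_ball (R : realType) (X : topologicalType)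
    (f : continuousType X R) (D : set X) (e : R) :
  0 < e -> dense D -> sup_ball f D e `<=` sup_ball f setT e.
Proof.
move=> e0 dD g /(sup_ballP _ _ _ e0)[d d0e fg]; apply/sup_ballP => //.
exists d => // x _; rewrite leNgt; apply/negP => dfg.
pose h z := `|f z - g z|.
have ch : continuous h.
  by move=> z; apply: cvg_norm; apply: cvgB; exact: cts_fun.
have oV : open (h @^-1` [set r | d < r]).
  by apply: open_comp; [move=> z _; exact: ch|exact: open_gt].
have [z [/= dz Dz]] := dD _ (ex_intro _ x dfg) oV.
by have := fg z Dz; rewrite leNgt => /negP.
Qed.

Lemma C_card_open_uniform (R : realType) (X : topologicalType)
    (kappa : infinite_cardinal) (D : set X) :
  dense D -> card_lt D [set: kappa] ->
  (@open (C_card R X kappa) : set (set (continuousType X R))) = @open (C_u R X).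
Proof.
move=> dD ltD; apply/funext => U; rewrite !openE; apply/propext.
suff nbhs_eq f : nbhs (f : C_card R X kappa) U <-> nbhs (f : C_u R X) U.
  by split => UU f /UU /nbhs_eq.
split=> [/C_card_nbhsP[A [e [e0 _ AU]]]|/C_u_nbhsP[e e0 eU]].
  apply/C_u_nbhsP; exists e => // g /(sup_ballP _ _ _ e0)[d de fg].
  by apply: AU; apply/sup_ballP => //; exists d => // x _; exact: fg.
apply/C_card_nbhsP; exists D, e; split => //.
exact: subset_trans (dense_sup_ball e0 dD) eU.
Qed.

(** * The truncated uniform distance: metric axioms, topology, completeness *)

Section uniform_distance.
Variables (R : realType) (X : topologicalType).
Implicit Types f g h : continuousType X R.

(* Truncation at [1] keeps the supremum finite, and the added [0] gives it the
   right value when [X] is empty. *)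
Definition dist_set f g : set R :=
  [set Num.min 1 `|f x - g x| | x in [set: X]] `|` [set 0].

Definition unif_dist f g : R := sup (dist_set f g).

Lemma unif_dist_leP f g (M : R) :
  unif_dist f g <= M <-> 0 <= M /\ forall x, Num.min 1 `|f x - g x| <= M.
Proof.
have hs : has_sup (dist_set f g).
  split; first by exists 0; right.
  by exists 1 => _ [[x _ <-]|->]; rewrite ?ge_min ?lexx.
split=> [dM|[M0 fgM]].
  split=> [|x]; apply: le_trans dM; apply: sup_upper_bound => //; first by right.
  by left; exists x.
apply: ge_sup; first by exists 0; right.
by move=> _ [[x _ <-]|->].
Qed.

Lemma unif_dist_ge0 f g : 0 <= unif_dist f g.
Proof. by have [] := (unif_dist_leP f g _).1 (lexx _). Qed.

Lemma unif_dist_ge f g x : Num.min 1 `|f x - g x| <= unif_dist f g.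
Proof. by have [_] := (unif_dist_leP f g _).1 (lexx _). Qed.

Lemma unif_dist_sym f g : unif_dist f g = unif_dist g f.
Proof.
apply/eqP; rewrite eq_le; apply/andP; split; apply/unif_dist_leP; split;
  rewrite ?unif_dist_ge0// => x; rewrite distrC; exact: unif_dist_ge.
Qed.

Lemma unif_dist_eq0 f g : unif_dist f g = 0 <-> f = g.
Proof.
split=> [fg0|->].
  apply/continuousEP => x; apply/eqP; rewrite -subr_eq0 -normr_le0.
  by have := unif_dist_ge f g x; rewrite fg0 ge_min ler10.
apply/eqP; rewrite eq_le unif_dist_ge0 andbT; apply/unif_dist_leP; split=> // x.
by rewrite subrr normr0 ge_min lexx orbT.
Qed.

Lemma unif_dist_triangle f g h :
  unif_dist f h <= unif_dist f g + unif_dist g h.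
Proof.
apply/unif_dist_leP; split; first by rewrite addr_ge0// unif_dist_ge0.
move=> x; apply: le_trans (lerD (unif_dist_ge f g x) (unif_dist_ge g h x)).
have := ler_distD (g x) (f x) (h x).
have := normr_ge0 (f x - g x); have := normr_ge0 (g x - h x).
(* If a term on the right is truncated, the sum is already at least 1; otherwise this is the usual
   triangle inequality. *)
by rewrite /Num.min; do 3! case: ifPn; rewrite -?leNgt; lra.
Qed.

(** Below the threshold 1 the truncation has no effect. *)
Lemma unif_dist_lt f g (e : R) x :
  e <= 1 -> unif_dist f g < e -> `|f x - g x| < e.
Proof.
move=> e1 /(le_lt_trans (unif_dist_ge f g x)).
by rewrite gt_min ltNge e1.
Qed.

Lemma sup_ball_unif_dist f g (e : R) :
  0 < e -> sup_ball f setT e g -> unif_dist f g < e.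
Proof.
move=> e0 /(sup_ballP _ _ _ e0)[d /andP[d0 de] fg].
apply: le_lt_trans de; apply/unif_dist_leP; split => [|x]; first exact: ltW.
by rewrite ge_min fg ?orbT.
Qed.

Lemma C_u_nbhs_unif_distP f (U : set (continuousType X R)) :
  nbhs (f : C_u R X) U <->
  exists2 e, 0 < e & [set g | unif_dist f g < e] `<=` U.
Proof.
split=> [/C_u_nbhsP[e e0 eU]|[e e0 eU]]; last first.
  by apply/C_u_nbhsP; exists e => // g /(sup_ball_unif_dist e0); exact: eU.
exists (Num.min (e / 2) 1); first by rewrite lt_min ltr01 andbT; lra.
move=> g /= fg; apply: eU; apply/sup_ballP => //; exists (e / 2); first lra.
move=> x _; have m1 : Num.min (e / 2) 1 <= 1 by rewrite ge_min lexx orbT.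
by have := unif_dist_lt x m1 fg; rewrite lt_min => /andP[/ltW].
Qed.

(** Pointwise limits exist by completeness of [R]. The Cauchy bound is uniform in [x] and passes to
    the limit, so convergence is uniform and the limit is continuous. *)
Lemma unif_dist_complete (u : nat -> continuousType X R) :
  (forall e, 0 < e ->
     exists N, forall m n, (N <= m)%N -> (N <= n)%N -> unif_dist (u m) (u n) < e) ->
  exists l, forall e, 0 < e -> \forall n \near \oo, unif_dist l (u n) < e.
Proof.
move=> cu.
have cauchy_at x : cauchy ((fun n => u n x) @ \oo).
  apply: cauchy_exP => e e0.
  have [N uN] : exists N, forall m n, (N <= m)%N -> (N <= n)%N ->
      unif_dist (u m) (u n) < Num.min e 1.
    by apply: cu; rewrite lt_min e0 ltr01.
  exists (u N x); exists N => // n Nn; rewrite /= -ball_normE/=.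
  have m1 : Num.min e 1 <= 1 by rewrite ge_min lexx orbT.
  by have := unif_dist_lt x m1 (uN _ _ (leqnn N) Nn); rewrite lt_min => /andP[].
have /choice[l lP] x : exists l : R, u n x @[n --> \oo] --> l.
  by move/cauchy_cvgP: (cauchy_at x) => cux; exists (lim (u n x @[n --> \oo])).
have unif_l e : 0 < e -> \forall n \near \oo, forall x, `|l x - u n x| <= e.
  move=> e0; have [N uN] : exists N, forall m n, (N <= m)%N -> (N <= n)%N ->
      unif_dist (u m) (u n) < Num.min e 1.
    by apply: cu; rewrite lt_min e0 ltr01.
  exists N => // n Nn x; apply/ler_addgt0Pr => d d0.
  have m1 : Num.min e 1 <= 1 by rewrite ge_min lexx orbT.
  have [M _ lM] : \forall m \near \oo, `|l x - u m x| < d.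
    by move/cvgrPdist_lt: (lP x); apply.
  have := lM _ (leq_maxr N M); rewrite /=.
  have := unif_dist_lt x m1 (uN _ _ (leq_maxl N M) Nn).
  rewrite lt_min => /andP[umn _] lum.
  by have := ler_distD (u (maxn N M) x) (l x) (u n x); lra.
have cl : continuous l.
  apply: (@uniform_limit_continuous X R ((fun n => u n : X -> R) @ \oo)).
    by exists 0%N => // n _ x; exact: (@cts_fun _ _ (u n) x).
  move=> V /uniform_nbhs[E [entE EV]].
  move: entE; rewrite -entourage_ballE => -[e /= e0 eE].
  have e2 : 0 < e / 2 by rewrite divr_gt0.
  have [N _ lN] := unif_l _ e2; exists N => // n /lN ln; apply: EV => x _.
  by apply: eE; rewrite /= -ball_normE/=; apply: le_lt_trans (ln x) _; lra.
exists (continuous_pack cl) => e e0.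
have e2 : 0 < e / 2 by rewrite divr_gt0.
have [N _ lN] := unif_l _ e2; exists N => // n /lN ln.
apply: sup_ball_unif_dist => //; apply/sup_ballP => //.
by exists (e / 2) => [|x _]; [lra|exact: ln].
Qed.

End uniform_distance.

Lemma completely_metrizable_uniform (R : realType) (X : topologicalType)
    (kappa : infinite_cardinal) :
  (@open (C_card R X kappa) : set (set (continuousType X R))) = @open (C_u R X) ->
  completely_metrizable (C_card R X kappa) R.
Proof.
move=> openE'; have nbhs_dist (f : continuousType X R) U :
    nbhs (f : C_card R X kappa) U <->
    exists2 e, 0 < e & [set g | unif_dist f g < e] `<=` U.
  rewrite -C_u_nbhs_unif_distP !nbhsE /open_nbhs.
  by split=> -[V [oV Vf] VU]; exists V => //; split => //; move: oV; rewrite openE'.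
exists (@unif_dist R X); split => //.
- split; [exact: unif_dist_ge0 | exact: unif_dist_eq0 | exact: unif_dist_sym
         | exact: unif_dist_triangle].
- move=> u /unif_dist_complete[l ul]; exists l => U /nbhs_dist[e e0 eU].
  by apply: filterS (ul e e0) => n; exact: eU.
Qed.

Lemma completely_metrizable_first_countable (R : realType) (Y : topologicalType) :
  completely_metrizable Y R -> first_countable Y.
Proof.
move=> [d [[_ d0 _ _] nbhs_d _]] y.
pose B n := [set z | d y z < n.+1%:R^-1].
exists (range B); first exact: card_image_le.
split=> [_ [n _ <-]|U /nbhs_d[e e0 eU]].
  by apply/nbhs_d; exists n.+1%:R^-1.
have [n _ ne] := near_infty_natSinv_lt (PosNum e0).
exists (B n); first by exists n.
by move=> z /= dz; apply: eU; apply: lt_trans dz (ne n (leqnn n)).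
Qed.

Theorem theorem4p1 (R : realType) (X : topologicalType)
    (kappa : infinite_cardinal) :
  tychonoff_space X ->
  ~ countable [set: kappa] ->
  [<-> (* 1 *) card_separable X kappa;
       (* 2 *) (@open (C_card R X kappa) : set (set (continuousType X R))) =
               @open (C_u R X);
       (* 3 *) completely_metrizable (C_card R X kappa) R;
       (* 4 *) first_countable (C_card R X kappa);
       (* 5 *) q_space (C_card R X kappa);
       (* 6 *) pointwise_countable_type (C_card R X kappa) ].
Proof.
move=> [crX _] ncount.
have sep_open : card_separable X kappa ->
    (@open (C_card R X kappa) : set (set (continuousType X R))) = @open (C_u R X).
  by move=> /(card_separableP X ncount)[D]; exact: C_card_open_uniform.
have q_sep := @q_space_card_separable R X kappa crX ncount.
have fc_pct := @first_countable_pointwise_countable_type (C_card R X kappa).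
have pct_q := @pointwise_countable_type_q_space (C_card R X kappa).
have open_fc := fun openE' => completely_metrizable_first_countable
  (@completely_metrizable_uniform R X kappa openE').
tfae.
- exact: sep_open.
- exact: completely_metrizable_uniform.
- exact: completely_metrizable_first_countable.
- by move=> /fc_pct/pct_q.
- by move=> /q_sep/sep_open/open_fc/fc_pct.
- by move=> /pct_q/q_sep.
Qed.
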